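(* Let $\mathbb{F}$ be a field and let $X$ be an arc of size $2k+1$ of $\mathrm{PG}(k-1,\mathbb{F})$ defining at most $2k-1$ linearly independent conditions on the space of quadratic forms on $\mathbb{F}^k$. Then $X$ is contained in a normal rational curve.
   Context: $\mathrm{PG}(k-1,\mathbb{F})$ denotes the $(k-1)$-dimensional projective space over the arbitrary field $\mathbb{F}$. An arc is a subset $S$ of points of $\mathrm{PG}(k-1,\mathbb{F})$ such that every hyperplane is incident with at most $k-1$ points of $S$. A quadratic form is a homogeneous polynomial of degree $2$ in $X_1,\ldots,X_k$ over $\mathbb{F}$. A set $X$ of points defines $r$ (linearly independent) conditions on the space of quadratic forms if the subspace of quadratic forms that are zero on $X$ has co-dimension $r$ in the space of all quadratic forms on $\mathbb{F}^k$. A normal rational curve is a set of points of $\mathrm{PG}(k-1,\mathbb{F})$ which is the image under an element of $\mathrm{PGL}(k,\mathbb{F})$ of $\{(1,t,t^2,\ldots,t^{k-1}) \mid t\in\mathbb{F}\}\cup\{(0,\ldots,0,1)\}$. *)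

(* Defs.v *)
From HB Require Import structures.
From mathcomp Require Import all_boot all_order all_algebra.
From mathcomp Require Import finmap mpoly.

Set Implicit Arguments.
Unset Strict Implicit.
Unset Printing Implicit Defensive.

Import GRing.Theory.
Local Open Scope ring_scope.
Local Open Scope fset_scope.

(* PG(k-1, F): its points are the one-dimensional subspaces of F^k and its
   hyperplanes are the (k-1)-dimensional ones; incidence is inclusion. *)
Record pg_point (F : fieldType) (k : nat) := PgPoint {
  pg_space :> {vspace 'rV[F]_k};
  _ : \dim pg_space == 1%N
}.
HB.instance Definition _ (F : fieldType) (k : nat) :=
  [isSub for @pg_space F k].
HB.instance Definition _ (F : fieldType) (k : nat) :=
  [Choice of pg_point F k by <:].

Definition is_arc (F : fieldType) (k : nat) (S : {fset pg_point F k}) : Prop :=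
  forall H : {vspace 'rV[F]_k}, \dim H = k.-1 ->
    (#|` [fset P in S | (P <= H)%VS]| <= k.-1)%N.

(* The finite-dimensional vector space structure on homogeneous polynomials is
   available only for a successor number of variables, hence k = n.+1. *)
Notation quadratic_form F n := (dhomog n.+1 F 2).

Definition form_eval (F : fieldType) (n : nat) (v : 'rV[F]_n.+1)
    (q : quadratic_form F n) : F :=
  (q : {mpoly F[n.+1]}).@[v 0].

Lemma form_eval_linear (F : fieldType) (n : nat) (v : 'rV[F]_n.+1) :
  linear (form_eval v : quadratic_form F n -> F^o).
Proof. by move=> a p q; rewrite /form_eval linearP. Qed.

HB.instance Definition _ (F : fieldType) (n : nat) (v : 'rV[F]_n.+1) :=
  GRing.isLinear.Build F (quadratic_form F n) F^o _
    (form_eval v : quadratic_form F n -> F^o) (form_eval_linear v).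

Definition zero_on (F : fieldType) (n : nat) (X : {fset pg_point F n.+1})
    (q : quadratic_form F n) : Prop :=
  forall P, P \in X -> forall v, v \in (P : {vspace _}) -> form_eval v q = 0.

Definition zero_space (F : fieldType) (n : nat) (X : {fset pg_point F n.+1}) :
    {vspace quadratic_form F n} :=
  (\bigcap_(P <- X)
     lker (linfun (form_eval (vpick P) : quadratic_form F n -> F^o)))%VS.

Lemma form_evalZ (F : fieldType) (n : nat) (a : F) (v : 'rV[F]_n.+1)
    (q : quadratic_form F n) :
  form_eval (a *: v) q = a ^+ 2 * form_eval v q.
Proof.
rewrite /form_eval !mevalE big_distrr /= !big_seq; apply: eq_bigr => m m_q.
have /dhomogP/(_ m m_q) /= deg_m := dhomog_is_dhomog q.
have -> : a ^+ 2 = \prod_i a ^+ m i by rewrite prodrXr -mdegE deg_m.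
rewrite mulrCA -big_split /=; congr (_ * _).
by apply: eq_bigr => i _; rewrite mxE exprMn.
Qed.

Lemma zero_spaceP (F : fieldType) (n : nat) (X : {fset pg_point F n.+1})
    (q : quadratic_form F n) :
  q \in zero_space X <-> zero_on X q.
Proof.
rewrite /zero_space; split=> [qX P PX v vP | qX].
  have Pv : v \in <[vpick P]>%VS.
    have /eqP dimP := valP P.
    have sub : (<[vpick P]> <= P)%VS by rewrite -memvE memv_pick.
    have nz : vpick P != 0 by rewrite vpick0 -dimv_eq0 dimP.
    suff -> : <[vpick P]>%VS = P by [].
    by apply/eqP; rewrite eqEdim sub dim_vline nz dimP.
  case/vlineP: Pv => a ->; rewrite form_evalZ.
  have : (q \in lker (linfun
            (form_eval (vpick P) : quadratic_form F n -> F^o))).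
    move: q qX; apply/subvP; rewrite (big_rem P) //=; exact: capvSl.
  by rewrite memv_ker lfunE /= => /eqP ->; rewrite mulr0.
rewrite big_seq; elim/big_rec: _ => [|P U PX qU]; first exact: memvf.
by rewrite memv_cap qU andbT memv_ker lfunE /= (qX P PX) ?memv_pick.
Qed.

(* The codimension, in the space of all quadratic forms, of the subspace of
   those that are zero on X. *)
Definition conditions (F : fieldType) (n : nat) (X : {fset pg_point F n.+1}) :
    nat :=
  (\dim {: quadratic_form F n} - \dim (zero_space X))%N.

Definition curve_point (F : fieldType) (k : nat) (t : F) : 'rV[F]_k :=
  \row_(i < k) t ^+ i.

Definition last_point (F : fieldType) (k : nat) : 'rV[F]_k :=
  \row_(i < k) (i.+1 == k)%:R.

Definition standard_nrc (F : fieldType) (k : nat) (P : pg_point F k) : Prop :=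
  (exists t : F, P = <[curve_point k t]>%VS :> {vspace _})
  \/ P = <[last_point F k]>%VS :> {vspace _}.

(* An element of PGL(k, F) is represented by an invertible matrix M, acting on
   row vectors by v |-> v *m M. *)
Definition is_nrc (F : fieldType) (k : nat) (C : pg_point F k -> Prop) : Prop :=
  exists2 M : 'M[F]_k, M \in unitmx &
    forall P, C P <-> exists2 Q, standard_nrc Q &
      P = (linfun (mulmxr M : 'rV[F]_k -> 'rV[F]_k) @: Q)%VS :> {vspace _}.

(* Main.v *)
(* Two hyperplanes separate any point of an arc from 2n others, so 2n+1 = 2k-1
   points of X impose independent conditions and every quadric through them
   contains all of X.  Take k points of X as coordinate frame e_0, ..., e_n, two
   more points u and w, and a further point y; let L be the remaining k-2
   points and N_i the linear form vanishing on L and e_i.  For suitable scalars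
   the quadric a N_i X_i - b N_j X_j contains the frame, L and u, hence also w
   and y.  As the N_i lie in a pencil, comparing the resulting ratios shows that
   the coordinatewise inverse of y is a linear combination of those of u and w,
   i.e. y_i is proportional to u_i / (t - u_i / w_i) for some t.  Clearing
   denominators, this is a point of the normal rational curve with coordinates
   u_i \prod_(j <> i) (t - u_j / w_j), which passes through e_i at
   t = u_i / w_i, through w at 0 and through u at infinity. *)

From HB Require Import structures.
Require Import Defs.
From mathcomp Require Import all_boot all_order all_algebra.
From mathcomp Require Import finmap mpoly.
From mathcomp Require Import ring zify.

Set Implicit Arguments.
Unset Strict Implicit.
Unset Printing Implicit Defensive.

Import GRing.Theory.
Local Open Scope ring_scope.

(** * Linear forms, and both hypotheses restated for indexed families of vectors *)

Definition lform (F : fieldType) (n : nat) (c : 'cV[F]_n) (v : 'rV[F]_n) : F :=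
  (v *m c) 0 0.

Lemma lformE (F : fieldType) (n : nat) (c : 'cV[F]_n) (v : 'rV[F]_n) :
  lform c v = \sum_i v 0 i * c i 0.
Proof. by rewrite /lform mxE. Qed.

Lemma lform_delta (F : fieldType) (n : nat) (c : 'cV[F]_n) (i : 'I_n) :
  lform c (delta_mx 0 i) = c i 0.
Proof. by rewrite /lform -rowE mxE. Qed.

Lemma lform_coord (F : fieldType) (n : nat) (i : 'I_n) (v : 'rV[F]_n) :
  lform (delta_mx i 0) v = v 0 i.
Proof. by rewrite /lform -colE mxE. Qed.

Lemma lformZ (F : fieldType) (n : nat) (a : F) (c : 'cV[F]_n) (v : 'rV[F]_n) :
  lform (a *: c) v = a * lform c v.
Proof. by rewrite /lform -scalemxAr mxE. Qed.

Lemma lformB (F : fieldType) (n : nat) (c d : 'cV[F]_n) (v : 'rV[F]_n) :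
  lform (c - d) v = lform c v - lform d v.
Proof. by rewrite /lform mulmxBr !mxE. Qed.

Definition arc_family (F : fieldType) (n : nat) (T : finType)
    (v : T -> 'rV[F]_n.+1) : Prop :=
  forall S : {set T}, #|S| = n ->
    exists c, forall j, (lform c (v j) == 0) = (j \in S).

(** Only quadrics of the shape ab - cd, with a, b, c, d linear forms, occur in the argument. *)
Definition quadrics_extend (F : fieldType) (n : nat) (T : finType)
    (v : T -> 'rV[F]_n.+1) : Prop :=
  forall (S : {set T}) (a b c d : 'cV[F]_n.+1), #|S| = (2 * n).+1 ->
    {in S, forall j, lform a (v j) * lform b (v j)
                     = lform c (v j) * lform d (v j)} ->
    forall j, lform a (v j) * lform b (v j) = lform c (v j) * lform d (v j).

(** * Arcs that contain the coordinate frame *)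

(** The hyperplane through the frame vectors other than e_i is X_i = 0, and it meets the arc nowhere
    else. *)
Lemma frame_coord_neq0 (F : fieldType) (n : nat) (T : finType)
    (v : T -> 'rV[F]_n.+1) (e : 'I_n.+1 -> T) :
  injective e -> (forall i, v (e i) = delta_mx 0 i) -> arc_family v ->
  forall j i, j \notin codom e -> v j 0 i != 0.
Proof.
move=> e_inj ve arcv j i je.
have /arcv [c cP] : #|e @: [set~ i]| = n.
  by rewrite card_imset // cardsC1 card_ord.
have c0 l : l != i -> c l 0 = 0.
  move=> li; apply/eqP; rewrite -lform_delta -ve cP imset_f //.
  by rewrite !inE.
have : lform c (v j) != 0.
  rewrite cP; apply: contra je => /imsetP [l _ ->]; exact: codom_f.
rewrite lformE (bigD1 i) //= big1 ?addr0 => [|l li]; last by rewrite c0 ?mulr0.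
by apply: contraNneq => ->; rewrite mul0r.
Qed.

(** The hyperplane through u and the frame vectors other than e_i, e_j involves only X_i and X_j;
    equal ratios at i and j would put w on it as well. *)
Lemma frame_ratio_inj (F : fieldType) (n : nat) (T : finType)
    (v : T -> 'rV[F]_n.+1) (e : 'I_n.+1 -> T) (u w : T) :
  injective e -> (forall i, v (e i) = delta_mx 0 i) -> arc_family v ->
  u \notin codom e -> w \notin codom e -> u != w ->
  injective (fun i => v u 0 i / v w 0 i).
Proof.
move=> e_inj ve arcv ue we uw i j; apply: contra_eq => ij.
have u0 l := frame_coord_neq0 e_inj ve arcv l ue.
have w0 l := frame_coord_neq0 e_inj ve arcv l we.
pose E := e @: (~: [set i; j]).
have uE : u \notin E by apply: contra ue => /imsetP [l _ ->]; exact: codom_f.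
have /arcv [c cP] : #|u |: E| = n.
  rewrite cardsU1 uE card_imset //.
  have := cardsC [set i; j]; rewrite cards2 ij card_ord /=; lia.
have c0 l : l != i -> l != j -> c l 0 = 0.
  move=> li lj; apply/eqP; rewrite -lform_delta -ve cP inE imset_f ?orbT //.
  by rewrite !inE negb_or li.
have sumE (k : T) : lform c (v k) = v k 0 i * c i 0 + v k 0 j * c j 0.
  rewrite lformE (bigD1 i) //= (bigD1 j) 1?eq_sym //= big1 ?addr0 // => l.
  by case/andP=> li lj; rewrite c0 ?mulr0.
have /eqP : lform c (v u) == 0 by rewrite cP setU11.
have : lform c (v w) != 0.
  rewrite cP !inE negb_or eq_sym uw /=.
  by apply: contra we => /imsetP [l _ ->]; exact: codom_f.
rewrite !sumE => cw cu; apply: contra_neq cw => /eqP.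
rewrite eqr_div // => /eqP uv.
apply: (mulfI (u0 i)); rewrite mulr0.
transitivity (v w 0 i * (v u 0 i * c i 0 + v u 0 j * c j 0)).
  by rewrite !mulrDr !mulrA uv; ring.
by rewrite cu mulr0.
Qed.

(** The conclusion is 1/y_i = (t/u_i - 1/w_i)/c: the coordinatewise inverse of y lies on the line
    joining those of u and w. *)
Lemma frame_cremona (F : fieldType) (n : nat) (T : finType)
    (v : T -> 'rV[F]_n.+1) (e : 'I_n.+1 -> T) (u w y : T) :
  injective e -> (forall i, v (e i) = delta_mx 0 i) ->
  #|T| = (2 * n).+3 -> arc_family v -> quadrics_extend v ->
  u \notin codom e -> w \notin codom e -> y \notin codom e ->
  u != w -> y != u -> y != w ->
  exists c t, forall i, t != v u 0 i / v w 0 i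
    /\ v y 0 i = c * (v u 0 i / (t - v u 0 i / v w 0 i)).
Proof.
move=> e_inj ve cardT arcv quadv ue we ye uw yu yw.
have u0 l := frame_coord_neq0 e_inj ve arcv l ue.
have w0 l := frame_coord_neq0 e_inj ve arcv l we.
have y0 l := frame_coord_neq0 e_inj ve arcv l ye.
pose E := [set j in codom e].
have cardE : #|E| = n.+1 by rewrite cardsE card_codom // card_ord.
pose L := ~: (E :|: [set u; w; y]).
have cardL : (#|L| + 2 = n.+1)%N.
  have := cardsC (E :|: [set u; w; y]); rewrite -/L cardT cardsU cardE.
  have -> : E :&: [set u; w; y] = set0.
    apply/setP=> j; rewrite !inE; case: eqP => [->|_]; first by rewrite (negPf ue).
    case: eqP => [->|_]; first by rewrite (negPf we).
    by case: eqP => [->|_]; rewrite ?(negPf ye) ?andbF.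
  have -> : #|[set u; w; y]| = 3.
    by rewrite setUC cardsU1 cards2 !inE negb_or yu yw uw.
  by rewrite cards0; lia.
have LE i : e i \notin L by rewrite !inE codom_f.
have [uL wL yL] : [/\ u \notin L, w \notin L & y \notin L].
  by split; rewrite !inE eqxx ?orbT.
(* [c1] and [c2] span the pencil of hyperplanes through L; [N i] below is its member vanishing at
   e_i. *)
have /arcv [c1 c1P] : #|u |: L| = n by rewrite cardsU1 uL; lia.
have /arcv [c2 c2P] : #|w |: L| = n by rewrite cardsU1 wL; lia.
pose s i := lform c1 (v (e i)); pose r i := lform c2 (v (e i)).
have notE j i : j \notin codom e -> e i != j.
  by apply: contraNneq => <-; exact: codom_f.
have s0 i : s i != 0 by rewrite c1P in_setU1 negb_or LE notE.
have r0 i : r i != 0 by rewrite c2P in_setU1 negb_or LE notE.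
have c1u : lform c1 (v u) = 0 by apply/eqP; rewrite c1P setU11.
have c2w : lform c2 (v w) = 0 by apply/eqP; rewrite c2P setU11.
have c1w : lform c1 (v w) != 0 by rewrite c1P in_setU1 negb_or eq_sym uw.
have c2u : lform c2 (v u) != 0 by rewrite c2P in_setU1 negb_or uw.
have c1y : lform c1 (v y) != 0 by rewrite c1P in_setU1 negb_or yu.
have c1L j : j \in L -> lform c1 (v j) = 0.
  by move=> jL; apply/eqP; rewrite c1P setU1r.
have c2L j : j \in L -> lform c2 (v j) = 0.
  by move=> jL; apply/eqP; rewrite c2P setU1r.
pose N i := s i *: c2 - r i *: c1.
have NE i j : lform (N i) (v j) = s i * lform c2 (v j) - r i * lform c1 (v j).
  by rewrite lformB !lformZ.
(* The quadric vanishes on the 2n+1 points of E, L and u. *)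
have quad i j k :
    s j * v u 0 j * (lform (N i) (v k) * v k 0 i) =
    s i * v u 0 i * (lform (N j) (v k) * v k 0 j).
  have cardS : #|u |: (E :|: L)| = (2 * n).+1.
    rewrite cardsU1 inE negb_or inE ue uL cardsU cardE.
    have -> : E :&: L = set0.
      by apply/setP=> l; rewrite !inE; case: (l \in codom e).
    by rewrite cards0; lia.
  (* The scalars balance both products at u, where N_i(u) = s_i c2(u). At e_m each product vanishes,
     since N_m(e_m) = 0. *)
  have := quadv _ ((s j * v u 0 j) *: N i) (delta_mx i 0)
    ((s i * v u 0 i) *: N j) (delta_mx j 0) cardS _ k.
  rewrite !lformZ !lform_coord !mulrA; apply=> l.
  rewrite !lformZ !lform_coord !NE !inE => /orP [/eqP -> | /orP [/codomP [m ->] | lL]].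
  - by rewrite c1u; ring.
  - rewrite -/(s m) -/(r m) ve !mxE /=.
    have [->|mi] := eqVneq i m; have [->|mj] := eqVneq j m => /=; ring.
  - have {}lL : l \in L by rewrite !inE.
    by rewrite c1L // c2L //; ring.
pose i0 : 'I_n.+1 := ord0.
(* At w, N_i(w) = -r_i c1(w), so [quad] makes r_i w_i proportional to s_i u_i; [k] is the factor,
   read off at [i0]. Likewise [m] comes from [quad] at y. *)
pose k := r i0 * v w 0 i0 / (s i0 * v u 0 i0).
have k0 : k != 0 by rewrite !(mulf_neq0, invr_neq0).
have kP i : r i = k * (s i * v u 0 i) / v w 0 i.
  have := quad i i0 w; rewrite !NE c2w !mulr0 !sub0r => q.
  have {}q : s i0 * v u 0 i0 * (r i * v w 0 i) = s i * v u 0 i * (r i0 * v w 0 i0).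
      by apply: (mulfI c1w); apply: oppr_inj; apply: (etrans (etrans _ q)); ring.
  apply: (mulIf (w0 i)); rewrite divfK // /k.
  apply: (mulfI (mulf_neq0 (s0 i0) (u0 i0))); rewrite q; field.
  by rewrite u0 s0.
pose m := lform (N i0) (v y) * v y 0 i0 / (s i0 * v u 0 i0).
have mP i : lform (N i) (v y) * v y 0 i = m * (s i * v u 0 i).
  apply: (mulfI (mulf_neq0 (s0 i0) (u0 i0))); rewrite quad /m; field.
  by rewrite u0 s0.
(* If m = 0, every N_i vanishes at y, so c2(y) c1 = c1(y) c2 as forms; this fails at u. *)
have m0 : m != 0.
  apply/eqP=> m0.
  have N0 i : s i * lform c2 (v y) = r i * lform c1 (v y).
    apply/eqP; rewrite -subr_eq0 -NE; have /eqP := mP i.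
    by rewrite m0 mul0r mulf_eq0 (negPf (y0 i)) orbF.
  have /eqP[] := mulf_neq0 c1y c2u.
  have -> : lform c1 (v y) * lform c2 (v u) = lform c2 (v y) * lform c1 (v u).
    rewrite [lform c2 (v u)]lformE [lform c1 (v u)]lformE !mulr_sumr.
    apply: eq_bigr => i _.
    have := N0 i; rewrite /s /r ve !lform_delta => N0i.
    by rewrite mulrCA [RHS]mulrCA [_ * c2 i 0]mulrC -N0i [c1 i 0 * _]mulrC.
  by rewrite c1u mulr0.
pose S := lform c1 (v y); pose R := lform c2 (v y).
(* Substituting r_i = k s_i u_i / w_i gives N_i(y) = s_i k S (t - u_i/w_i) with t = R/(kS); dividing
   m s_i u_i by this yields y_i. *)
exists (m / (k * S)), (R / (k * S)) => i.
have NiE : lform (N i) (v y) = s i * (k * S) * (R / (k * S) - v u 0 i / v w 0 i).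
  by rewrite NE -/S -/R kP; field; rewrite w0 c1y k0.
have d0 : R / (k * S) - v u 0 i / v w 0 i != 0.
  apply/eqP=> d0; have := mP i; rewrite NiE d0 mulr0 mul0r => /esym/eqP.
  by apply/negP; exact: mulf_neq0 m0 (mulf_neq0 (s0 i) (u0 i)).
split; first by rewrite -subr_eq0.
have kS : s i * (k * S) != 0 by exact: mulf_neq0 (s0 i) (mulf_neq0 k0 c1y).
apply: (mulfI (mulf_neq0 kS d0)); rewrite -[in LHS]NiE mP.
set d := _ - _ in d0 *; field.
by rewrite d0 c1y k0.
Qed.

(** * The normal rational curve through the frame *)

Lemma unitmx_of_diag (F : fieldType) (n : nat) (B C : 'M[F]_n) :
  (forall i j, ((B *m C) i j == 0) = (i != j)) ->
  (B \in unitmx) /\ (C \in unitmx).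
Proof.
move=> BC; apply/andP; rewrite -unitmx_mul.
move: (B *m C) BC => D D0.
have -> : D = diag_mx (\row_i D i i).
  apply/matrixP=> i j; rewrite !mxE.
  have [<-|ij] := eqVneq i j; first by rewrite mulr1n.
  by apply/eqP; rewrite mulr0n D0.
rewrite unitmxE det_diag unitfE; apply/prodf_neq0 => i _.
by rewrite mxE D0 eqxx.
Qed.

(** Column i of [M] holds the coefficients of the Lagrange-type polynomial u_i \prod_(j <> i) (X -
    a_j). The Vandermonde matrix of [a] times [M] is diagonal with nonzero diagonal, so [M] is
    invertible; the leading coefficients u_i give the image of the point at infinity. *)
Lemma curve_matrix (F : fieldType) (n : nat) (u a : 'I_n.+1 -> F) :
  (forall i, u i != 0) -> injective a ->
  exists2 M : 'M[F]_n.+1, M \in unitmx &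
    (forall t, curve_point n.+1 t *m M
               = \row_i (u i * \prod_(j | j != i) (t - a j)))
    /\ last_point F n.+1 *m M = \row_i u i.
Proof.
move=> u0 a_inj.
pose g i : {poly F} := \prod_(j | j != i) ('X - (a j)%:P).
have size_g i : size (g i) = n.+1.
  rewrite /g (_ : \prod_(j | _) _ = \prod_(j <- enum (predC1 i)) ('X - (a j)%:P)).
    by rewrite size_prod_XsubC -cardE cardC1 card_ord.
  by rewrite big_enum.
have lead_g i : (g i)`_n = 1.
  have /monicP := monic_prod_XsubC (index_enum 'I_n.+1) (fun j => j != i) a.
  by rewrite lead_coefE -/(g i) size_g.
pose M := \matrix_(l < n.+1, i < n.+1) (u i * (g i)`_l).
have curveM t : curve_point n.+1 t *m M
    = \row_i (u i * \prod_(j | j != i) (t - a j)).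
  apply/rowP=> i; rewrite !mxE.
  transitivity (u i * (g i).[t]).
    rewrite (@horner_coef_wide _ n.+1) ?size_g // mulr_sumr.
    by apply: eq_bigr => l _; rewrite !mxE; ring.
  rewrite horner_prod; congr (_ * _); apply: eq_bigr => j _.
  by rewrite hornerXsubC.
exists M; last split=> //.
  apply: (proj2 (@unitmx_of_diag _ _ (\matrix_j curve_point n.+1 (a j)) M _)) => j i.
  have -> : ((\matrix_k curve_point n.+1 (a k)) *m M) j i
            = (curve_point n.+1 (a j) *m M) 0 i.
    by rewrite mxE [RHS]mxE; apply: eq_bigr => l _; rewrite !mxE.
  rewrite curveM mxE mulf_eq0 (negPf (u0 i)) /=.
  apply/prodf_eq0/idP=> [[k ki] | ji].
    by rewrite subr_eq0 => /eqP /a_inj ->.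
  by exists j; rewrite // subrr.
apply/rowP=> i; rewrite !mxE (bigD1 ord_max) //= big1 => [|l lm].
  by rewrite !mxE /= eqxx lead_g addr0 mul1r mulr1.
by rewrite !mxE eqSS -(inj_eq val_inj) /= in lm *; rewrite (negPf lm) mul0r.
Qed.

(** The scalar [c] absorbs the choice of representative; it may be zero, so the condition has
    content only for nonzero [x]. *)
Definition on_curve (F : fieldType) (k : nat) (M : 'M[F]_k) (x : 'rV[F]_k) :
    Prop :=
  exists c : F, (exists t : F, x = c *: (curve_point k t *m M))
                \/ x = c *: (last_point F k *m M).

Lemma frame_on_curve (F : fieldType) (n : nat) (T : finType)
    (v : T -> 'rV[F]_n.+1) (e : 'I_n.+1 -> T) :
  injective e -> (forall i, v (e i) = delta_mx 0 i) ->
  #|T| = (2 * n).+3 -> arc_family v -> quadrics_extend v ->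
  exists2 M : 'M[F]_n.+1, M \in unitmx & forall j, on_curve M (v j).
Proof.
move=> e_inj ve cardT arcv quadv.
have /card_gt1P [u [w [ue we uw]]] : (1 < #|~: [set j in codom e]|)%N.
  by have := cardsC [set j in codom e]; rewrite cardsE card_codom // card_ord cardT; lia.
rewrite !inE in ue we.
have u0 l := frame_coord_neq0 e_inj ve arcv l ue.
have w0 l := frame_coord_neq0 e_inj ve arcv l we.
pose a i := v u 0 i / v w 0 i.
have a_inj : injective a := frame_ratio_inj e_inj ve arcv ue we uw.
have [M Mu [curveM lastM]] := curve_matrix u0 a_inj.
exists M => // j.
have affine_point c t :
    (forall i, t != a i /\ v j 0 i = c * (v u 0 i / (t - a i))) ->
    on_curve M (v j).
  (* Multiplying by the product of all t - a_i clears the denominators. *)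
  move=> ct; exists (c / \prod_i (t - a i)); left; exists t.
  apply/rowP=> i; rewrite curveM !mxE (proj2 (ct i)) (bigD1 i) //=.
  have p0 : \prod_(k < n.+1 | k != i) (t - a k) != 0.
    by apply/prodf_neq0 => k _; rewrite subr_eq0 (proj1 (ct k)).
  have d0 : t - a i != 0 by rewrite subr_eq0 (proj1 (ct i)).
  by field; rewrite p0 d0.
have [/codomP [i ->] | je] := boolP (j \in codom e).
  (* At t = a_i every coordinate but the i-th has a zero factor; the scalar normalises the i-th to
     1. *)
  exists (v u 0 i * \prod_(k | k != i) (a i - a k))^-1; left; exists (a i).
  have p0 : \prod_(k < n.+1 | k != i) (a i - a k) != 0.
    by apply/prodf_neq0 => k ki; rewrite subr_eq0 (inj_eq a_inj) eq_sym.
  rewrite curveM ve; apply/rowP=> l; rewrite !mxE /=.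
  have [->|li] := eqVneq l i; first by rewrite mulVf ?mulf_neq0.
  by rewrite [\prod_(k | k != l) _](bigD1 i) 1?eq_sym //= subrr mul0r !mulr0.
have [->|ju] := eqVneq j u.
  by exists 1; right; rewrite lastM scale1r; apply/rowP=> i; rewrite mxE.
have [jw|jw] := eqVneq j w.
  (* At t = 0 the quotient u_i / (t - u_i/w_i) is -w_i, hence the factor -1. *)
  apply: (affine_point (-1) 0) => i; rewrite eq_sym mulf_neq0 ?invr_eq0 //.
  by split=> //; rewrite jw /a; field; rewrite w0 oppr_eq0 u0.
by have [c [t]] := frame_cremona e_inj ve cardT arcv quadv ue we je uw ju jw;
   exact: affine_point.
Qed.

(** Any n+1 members form a basis [B], because the arc property supplies forms dual to them up to
    scalars. Both hypotheses survive the change of basis to the frame, and [A *m B] carries the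
    curve back. *)
Lemma arc_quadrics_on_curve (F : fieldType) (n : nat) (T : finType)
    (v : T -> 'rV[F]_n.+1) :
  #|T| = (2 * n).+3 -> arc_family v -> quadrics_extend v ->
  exists2 M : 'M[F]_n.+1, M \in unitmx & forall j, on_curve M (v j).
Proof.
move=> cardT arcv quadv.
have leT : (n.+1 <= #|T|)%N by rewrite cardT; lia.
pose e (i : 'I_n.+1) : T := enum_val (widen_ord leT i).
have e_inj : injective e.
  by move=> i j /enum_val_inj /(congr1 val) /= ij; exact: val_inj.
have /fin_all_exists [c cP] (i : 'I_n.+1) :
    exists d, forall j, (lform d (v j) == 0) = (j \in e @: [set~ i]).
  by apply: arcv; rewrite card_imset // cardsC1 card_ord.
pose B := \matrix_i v (e i).
have [Bu _] : (B \in unitmx) /\ ((\matrix_i (c i)^T)^T \in unitmx).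
  apply: unitmx_of_diag => i j.
  have -> : (B *m (\matrix_i (c i)^T)^T) i j = lform (c j) (v (e i)).
    by rewrite lformE mxE; apply: eq_bigr => l _; rewrite !mxE.
  by rewrite cP mem_imset // !inE.
have lformV a j : lform a (v j *m invmx B) = lform (invmx B *m a) (v j).
  by rewrite /lform mulmxA.
have [||||A Au onA] := @frame_on_curve F n T (fun j => v j *m invmx B) e e_inj.
- by move=> i; rewrite -(rowK (fun l => v (e l))) -row_mul mulmxV // row1.
- exact: cardT.
- move=> S /arcv [d dP]; exists (B *m d) => j.
  by rewrite lformV mulKmx.
- move=> S a b d f cardS eqS j; rewrite !lformV.
  by apply: (quadv S) => // l lS; rewrite -!lformV eqS.
exists (A *m B); first by rewrite unitmx_mul Au.
move=> j; have [d dP] := onA j.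
by exists d; case: dP => [[t]|] dE; [left; exists t | right];
  rewrite -[LHS](mulmxKV Bu) dE -scalemxAl mulmxA.
Qed.

(** * From arcs of projective points to families of vectors *)

Lemma dimv_lker_mulmxr (F : fieldType) (n : nat) (c : 'cV[F]_n.+1) :
  c != 0 -> \dim (lker (linfun (mulmxr c : 'rV[F]_n.+1 -> 'rV[F]_1))) = n.
Proof.
move=> c0; set f := linfun _.
have := limg_ker_dim f fullv; rewrite capfv !dimvf.
have limg1 : (0 < \dim (f @: fullv))%N.
  rewrite lt0n dimv_eq0; apply: contraNneq c0 => f0.
  apply/eqP/colP=> i; rewrite mxE -lform_delta /lform.
  have : f (delta_mx 0 i) \in (f @: fullv)%VS by rewrite memv_img ?memvf.
  by rewrite f0 memv0 lfunE /= => /eqP ->; rewrite mxE.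
have := dimvS (subvf (f @: fullv)); rewrite dimvf /dim /= !mul1n => ? ?.
by apply/eqP; lia.
Qed.

Lemma pg_pointE (F : fieldType) (k : nat) (P : pg_point F k) :
  pg_space P = <[vpick P]>%VS.
Proof.
have /eqP dimP := valP P.
apply/esym/eqP; rewrite eqEdim -memvE memv_pick dim_vline.
by rewrite vpick0 -dimv_eq0 dimP.
Qed.

Lemma pg_vpick_neq0 (F : fieldType) (k : nat) (P : pg_point F k) :
  vpick P != 0.
Proof. by have /eqP dimP := valP P; rewrite vpick0 -dimv_eq0 dimP. Qed.

(** Some hyperplane contains the n chosen vectors; it contains at most n points of the arc, hence no
    others. *)
Lemma is_arc_family (F : fieldType) (n : nat) (X : {fset pg_point F n.+1}) :
  is_arc X -> arc_family (fun P : X => vpick (val P)).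
Proof.
move=> arcX S cardS.
pose A := \matrix_(l < #|S|) vpick (val (enum_val l)).
have [c c0 Ac] : exists2 c : 'cV[F]_n.+1, c != 0 & A *m c = 0.
  have : cokermx A != 0.
    rewrite -mxrank_eq0 mxrank_coker -lt0n subn_gt0 ltnS.
    by apply: leq_trans (rank_leq_row A) _; rewrite cardS.
  rewrite -trmx_eq0 => /rowV0Pn [r].
  rewrite -trmx_eq0 => /submxP [d ->] rn0.
  by exists (d *m (cokermx A)^T)^T; rewrite // trmx_mul trmxK mulmxA mulmx_coker mul0mx.
exists c => P.
pose Z := [set Q : X | lform c (vpick (val Q)) == 0].
have ZE Q : (Q \in Z) = (val Q <= lker (linfun (mulmxr c : 'rV[F]_n.+1 -> 'rV[F]_1)))%VS.
  rewrite inE [X in (X <= _)%VS]pg_pointE -memvE memv_ker lfunE /=.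
  apply/eqP/eqP=> z; last by rewrite /lform [_ *m _]z mxE.
  by apply/matrixP=> i j; rewrite !ord1 [RHS]mxE.
have SZ : S \subset Z.
  apply/subsetP=> Q QS; rewrite inE /lform.
  have := congr1 (row (enum_rank_in QS Q)) Ac.
  by rewrite row_mul rowK enum_rankK_in // row0 => ->; rewrite mxE.
suff -> : S = Z by rewrite inE.
apply/eqP; rewrite eqEcard SZ cardS /=.
apply: leq_trans (arcX _ (dimv_lker_mulmxr c0)).
have <- : #|` [fset val Q | Q in Z]%fset| = #|Z|.
  by rewrite card_imfset /= ?cardE //; exact: val_inj.
apply: fsubset_leq_card; apply/fsubsetP=> Q /imfsetP [R /= RZ ->].
by rewrite !inE (valP R) /= -ZE.
Qed.

(** * Independent conditions on quadratic forms *)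

Definition linear_poly (F : fieldType) (n : nat) (c : 'cV[F]_n) :
    {mpoly F[n]} := \sum_i c i 0 *: 'X_i.

Lemma linear_polyM_dhomog (F : fieldType) (n : nat) (c d : 'cV[F]_n) :
  linear_poly c * linear_poly d \is 2.-homog.
Proof.
have homog1 (b : 'cV[F]_n) : linear_poly b \is 1.-homog.
  by apply: rpred_sum => i _; apply: rpredZ; rewrite dhomogX /= mdeg1.
exact: (dhomogM (homog1 c) (homog1 d)).
Qed.

Definition quadric_prod (F : fieldType) (n : nat) (c d : 'cV[F]_n.+1) :
  quadratic_form F n := DHomog (linear_polyM_dhomog c d).

Lemma form_eval_prod (F : fieldType) (n : nat) (c d : 'cV[F]_n.+1)
    (v : 'rV[F]_n.+1) :
  form_eval v (quadric_prod c d) = lform c v * lform d v.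
Proof.
have evalE (b : 'cV[F]_n.+1) : (linear_poly b).@[v 0] = lform b v.
  rewrite lformE raddf_sum /=; apply: eq_bigr => i _.
  by rewrite mevalZ mevalXU mulrC.
by rewrite /form_eval /= mevalM !evalE.
Qed.

(** Split [S] into two halves of size n and multiply the forms of the hyperplanes through them;
    neither contains the point j. *)
Lemma arc_separating_quadric (F : fieldType) (n : nat) (T : finType)
    (v : T -> 'rV[F]_n.+1) (S : {set T}) (j : T) :
  arc_family v -> #|S| = (2 * n)%N -> j \notin S ->
  exists2 q : quadratic_form F n,
    form_eval (v j) q != 0 & {in S, forall i, form_eval (v i) q = 0}.
Proof.
move=> arcv cardS jS.
have : (0 < #|[set B : {set T} | B \subset S & #|B| == n]|)%N.
  by rewrite cards_draws bin_gt0 cardS; lia.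
case/card_gt0P=> S1; rewrite inE => /andP [S1S /eqP cardS1].
have cardS2 : #|S :\: S1| = n.
  by rewrite cardsD (setIidPr S1S) cardS cardS1; lia.
have [c cP] := arcv _ cardS1; have [d dP] := arcv _ cardS2.
exists (quadric_prod c d) => [|i iS]; rewrite form_eval_prod.
  rewrite mulf_neq0 // ?cP ?dP ?inE ?(negPf jS) ?andbF //.
  by apply: contra jS; apply/subsetP.
apply/eqP; rewrite mulf_eq0 cP dP inE iS andbT; exact: orbN.
Qed.

(* [zero_space X] lies in the kernel of the evaluations at [S], which has
   codimension 2n+1 because they are independent. *)
Lemma zero_on_extend (F : fieldType) (n : nat) (X : {fset pg_point F n.+1})
    (S : {set X}) (q : quadratic_form F n) :
  is_arc X -> (conditions X <= (2 * n).+1)%N -> #|S| = (2 * n).+1 ->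
  (forall P : X, P \in S -> form_eval (vpick (val P)) q = 0) -> q \in zero_space X.
Proof.
move=> arcX condX cardS qS; have arcv := is_arc_family arcX.
pose ev (p : quadratic_form F n) : 'rV[F]_#|S| :=
  \row_l form_eval (vpick (val (enum_val l : X))) p.
have ev_linear : linear ev.
  by move=> a p r; apply/rowP=> l; rewrite !mxE linearP.
pose evl := GRing.isLinear.Build F _ _ _ ev ev_linear.
pose evL : {linear quadratic_form F n -> 'rV[F]_#|S|} := HB.pack ev evl.
pose f := linfun evL.
have fE p : f p = ev p by rewrite lfunE.
have f_full : (f @: fullv)%VS = fullv.
  apply/eqP; rewrite eqEsubv subvf /=; apply/subvP=> x _.
  rewrite [x]row_sum_delta; apply: rpred_sum => l _; apply: rpredZ.
  pose P : X := enum_val l.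
  have PS : P \in S by exact: enum_valP.
  have cardP : #|S :\ P| = (2 * n)%N.
    by have := cardsD1 P S; rewrite PS cardS add1n => -[<-].
  (* Surjectivity: a quadric through the other 2n points but not through [P], rescaled, maps to the
     l-th basis vector. *)
  have [|p pP pS] := arc_separating_quadric arcv cardP (j := P).
    by rewrite !inE eqxx.
  have -> : delta_mx 0 l = f ((form_eval (vpick (val P)) p)^-1 *: p).
    rewrite linearZ /= fE; apply/rowP=> m; rewrite !mxE /=.
    have [->|ml] := eqVneq m l; first by rewrite mulVf.
    rewrite (pS (enum_val m)) ?mulr0 // !inE enum_valP andbT.
    by rewrite (inj_eq enum_val_inj).
  by rewrite memv_img ?memvf.
have ZK : (zero_space X <= lker f)%VS.
  apply/subvP=> p /zero_spaceP pX; rewrite memv_ker fE; apply/eqP/rowP=> l.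
  by rewrite !mxE (pX (val (enum_val l))) ?(valP (enum_val l)) ?memv_pick.
have qK : q \in lker f.
  rewrite memv_ker fE; apply/eqP/rowP=> l.
  by rewrite !mxE qS ?enum_valP.
suff /eqP -> : zero_space X == lker f by [].
(* By [condX], [zero_space X] has codimension at most 2n+1, which is the codimension of [lker f]. *)
rewrite eqEdim ZK /=.
have dim_f : \dim (f @: fullv) = (2 * n).+1.
  by rewrite f_full dimvf /dim /= mul1n.
have := limg_ker_dim f fullv; rewrite capfv dim_f.
by move=> dim_ker; move: condX; rewrite /conditions -dim_ker leq_subLR leq_add2r.
Qed.

Lemma is_arc_quadrics_extend (F : fieldType) (n : nat)
    (X : {fset pg_point F n.+1}) :
  is_arc X -> (conditions X <= (2 * n).+1)%N ->
  quadrics_extend (fun P : X => vpick (val P)).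
Proof.
move=> arcX condX S a b c d cardS eqS P.
have : quadric_prod a b - quadric_prod c d \in zero_space X.
  apply: (zero_on_extend arcX condX cardS) => Q QS.
  by rewrite linearB /= !form_eval_prod eqS ?subrr.
move=> /zero_spaceP /(_ _ (valP P) _ (memv_pick _)).
by rewrite linearB /= !form_eval_prod => /eqP; rewrite subr_eq0 => /eqP.
Qed.

(** * Back to points of the projective space *)

(** Since [vpick P] is nonzero, neither the scalar nor the curve vector [x] vanishes, so [x] spans a
    point whose image is [P]. *)
Lemma line_on_nrc (F : fieldType) (n : nat) (M : 'M[F]_n.+1) (P : pg_point F n.+1) :
  M \in unitmx -> on_curve M (vpick P) ->
  exists2 Q, standard_nrc Q &
    P = (linfun (mulmxr M : 'rV[F]_n.+1 -> 'rV[F]_n.+1) @: Q)%VS :> {vspace _}.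
Proof.
move=> Mu [c onM].
have [x xP Px] : exists2 x, (exists t, x = curve_point n.+1 t) \/ x = last_point F n.+1
    & vpick P = c *: (x *m M).
  by case: onM => [[t]|] ->; [exists (curve_point n.+1 t); first by left; exists t
                            | exists (last_point F n.+1); first by right].
have := pg_vpick_neq0 P; rewrite Px scaler_eq0 negb_or => /andP [c0 xM0].
have x0 : x != 0 by apply: contraNneq xM0 => ->; rewrite mul0mx.
have dimx : \dim <[x]>%VS == 1%N by rewrite dim_vline x0.
exists (PgPoint dimx).
  by case: xP => [[t]|] xE; [left; exists t | right]; rewrite /= xE.
rewrite /= limg_line lfunE /= pg_pointE Px.
apply/eqP; rewrite eqEdim !dim_vline xM0 scaler_eq0 negb_or c0 xM0 andbT.
by rewrite -memvE memvZ ?memv_line.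
Qed.

Local Close Scope ring_scope.
Local Open Scope fset_scope.

Theorem theorem6 (F : fieldType) (n : nat) (X : {fset pg_point F n.+1}) :
  is_arc X ->
  #|` X| = (2 * n.+1 + 1)%N ->
  (conditions X <= 2 * n.+1 - 1)%N ->
  exists2 C : pg_point F n.+1 -> Prop,
    is_nrc C & forall P, P \in X -> C P.
Proof.
move=> arcX cardX condX.
(* With k = n+1, the numbers 2k-1 and 2k+1 become 2n+1 and 2n+3. *)
have {}condX : (conditions X <= (2 * n).+1)%N by lia.
have cardT : #|{: X}| = (2 * n).+3 by rewrite -cardfE cardX; lia.
have [M Mu onM] := arc_quadrics_on_curve cardT (is_arc_family arcX)
  (is_arc_quadrics_extend arcX condX).
exists (fun P => exists2 Q, standard_nrc Q &
    P = (linfun (mulmxr M : 'rV[F]_n.+1 -> 'rV[F]_n.+1) @: Q)%VS :> {vspace _}).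
  by exists M.
by move=> P PX; exact: line_on_nrc Mu (onM [` PX]).
Qed.
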